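(* Let $S_1,\ldots,S_m\subseteq\{1,\ldots,d\}$ and let $\Delta\in\mathbb{R}^{m\times d}$ be the matrix with $\Delta_{ji}=1$ if $i\in S_j$ and $\Delta_{ji}=0$ otherwise. Suppose that the linear program $$(\text{sLP})\qquad \text{minimize } \mathbf{1}_m^T s \ \text{ subject to } \ \mathbf{1}_d^T\le s^T\Delta,\quad s\ge 0,$$ for $s=(s_1,\ldots,s_m)^T$ is feasible, and let $s_{\mathrm{HBL}}$ be its optimal value. Then the dual linear program $$(\text{xLP})\qquad \text{maximize } \mathbf{1}_d^T x \ \text{ subject to } \ \mathbf{1}_m\ge\Delta x,\quad x\ge 0,$$ for $x=(x_1,\ldots,x_d)^T$ is also feasible, and using the values of an optimal solution $x$ of (xLP) as the tile exponents in the tiled code lets the tiled code attain the communication lower bound of $\Omega(N^d/M^{s_{\mathrm{HBL}}-1})$ words moved.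
   Context: $\mathbf{1}_k$ denotes the all-ones column vector in $\mathbb{R}^k$, and vector inequalities are componentwise. **Original code.** The program is: for $i_1=1:N$, for $i_2=1:N$, ..., for $i_d=1:N$, run $\text{inner\_loop}(i_1,\ldots,i_d)$. Each execution of inner_loop accesses, for each $j\in\{1,\ldots,m\}$, the entry $A_j(\phi_j(i_1,\ldots,i_d))$ of array $A_j$, where $\phi_j$ selects the loop indices $i_k$ with $k\in S_j$. All reorderings of the iterations are permitted (dependencies are ignored). **Tiled code.** For parameters $x_1,\ldots,x_d$ the tiled code is: for $j_1=1:M^{x_1}:N$, ..., for $j_d=1:M^{x_d}:N$ (start : step : end), for $k_1=0:M^{x_1}-1$, ..., for $k_d=0:M^{x_d}-1$, set $(i_1,\ldots,i_d)=(j_1,\ldots,j_d)+(k_1,\ldots,k_d)$ and run $\text{inner\_loop}(i_1,\ldots,i_d)$. **Cost model.** The code runs sequentially on a machine with a fast memory of $M$ words and an unbounded slow memory. Computation is performed only on data in fast memory, and the communication cost is the number of words moved between slow and fast memory. The asymptotic parameters are $N$ and $M$; $m$, $d$ and the $S_j$ are constants, constant factors are ignored (block sizes may be reduced by a constant factor so that all data of one tile fits in fast memory), and fractions such as $N/M^{x_i}$ are assumed to divide evenly. The lower bound: for large problems, any sequential execution that only reorders inner loop iterations (without interleaving them, and without array variables being allocated in fast memory and later discarded without being written) moves $\Omega(N^d/M^{s_{\mathrm{HBL}}-1})$ words. ''Attain'' means that the tiled code performs the iterations while moving $O(N^d/M^{s_{\mathrm{HBL}}-1})$ words. *)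

(* Defs.v *)
From mathcomp Require Import all_boot all_order all_algebra.
From mathcomp Require Import boolp classical_sets reals exp.

Set Implicit Arguments.
Unset Strict Implicit.
Unset Printing Implicit Defensive.

Import Order.TTheory GRing.Theory Num.Theory.

Local Open Scope ring_scope.

Section LinearPrograms.
Variables (R : realType) (d m : nat) (S : 'I_m -> {set 'I_d}).

Definition lemx p q (A B : 'M[R]_(p, q)) : Prop := forall i j, A i j <= B i j.

Definition ones k : 'cV[R]_k := const_mx 1.

Definition Delta : 'M[R]_(m, d) := \matrix_(j, i) (i \in S j)%:R.

Definition objective k (v : 'cV[R]_k) : R := ((ones k)^T *m v) 0 0.

Definition sLP_feasible (s : 'cV[R]_m) : Prop :=
  lemx (ones d)^T (s^T *m Delta) /\ lemx 0 s.

(* [inf] is the genuine infimum as soon as the sLP is feasible, since the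
   objective is bounded below by 0. *)
Definition sHBL : R :=
  inf [set objective s | s in [set s : 'cV[R]_m | sLP_feasible s]]%classic.

Definition xLP_feasible (x : 'cV[R]_d) : Prop :=
  lemx (Delta *m x) (ones m) /\ lemx 0 x.

Definition xLP_optimal (x : 'cV[R]_d) : Prop :=
  xLP_feasible x /\ forall y, xLP_feasible y -> objective y <= objective x.

End LinearPrograms.

Section Code.
Variables (d m : nat) (S : 'I_m -> {set 'I_d}).

Definition iteration : Type := {ffun 'I_d -> nat}.

(* The loop range start : step : stop, both ends included. *)
Definition colon (start step stop : nat) : seq nat :=
  [seq i <- iota start (stop.+1 - start) | (step %| i - start)%N].

Fixpoint lex_product (rs : seq (seq nat)) : seq (seq nat) :=
  if rs is r :: rs' then [seq i :: t | i <- r, t <- lex_product rs']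
  else [:: [::]].

(* The values taken by the indices of d nested loops, in execution order;
   the loop of index 0 is the outermost one. *)
Definition loop_nest (r : 'I_d -> seq nat) : seq iteration :=
  [seq [ffun k : 'I_d => nth 0%N t k]
     | t <- lex_product [seq r k | k <- enum 'I_d]].

Definition original_code (N : nat) : seq iteration :=
  loop_nest (fun=> colon 1 1 N).

Definition tile (b : 'I_d -> nat) (j : iteration) : seq iteration :=
  [seq [ffun l => (j l + k l)%N] | k : iteration <- loop_nest (fun l => colon 0 1 (b l).-1)].

Definition tiled_code (N : nat) (b : 'I_d -> nat) : seq iteration :=
  flatten [seq tile b j | j <- loop_nest (fun l => colon 1 (b l) N)].

(* The word (j, phi_j(i)) is the entry of array A_j at the selected indices,
   listed in increasing order of k \in S j. *)
Definition word : Type := ('I_m * seq nat)%type.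

Definition phi (j : 'I_m) (i : iteration) : seq nat := [seq i k | k in S j].

Definition accesses (i : iteration) : seq word :=
  [seq (j, phi j i) | j <- enum 'I_m].

Definition words_of (its : seq iteration) : seq word :=
  undup (flatten [seq accesses i | i <- its]).

End Code.

(* Sequential machine with two levels of memory. A state is the list of words
   currently in fast memory. Since the inner loop may modify any entry it
   accesses, a word leaves fast memory only by being written back; every word
   in fast memory has been fetched, so this at most doubles the count of words
   moved compared with a machine that discards unmodified words for free. *)
Section Machine.
Variables (d m : nat) (S : 'I_m -> {set 'I_d}).

Inductive instr : Type :=
  | Fetch of word m
  | Store of word m
  | Exec of iteration d.

Definition step (M : nat) (F : seq (word m)) (a : instr) :
    option (seq (word m)) :=
  match a with
  | Fetch w => if (w \notin F) && (size F < M)%N then Some (w :: F) else None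
  | Store w => if w \in F then Some (rem w F) else None
  | Exec i => if all (fun w => w \in F) (accesses S i) then Some F else None
  end.

(* Every instruction is legal, and fast memory is empty before and after. *)
Definition legal (M : nat) (p : seq instr) : Prop :=
  foldl (fun o a => obind (fun F => step M F a) o) (Some [::]) p = Some [::].

Definition executed (p : seq instr) : seq (iteration d) :=
  pmap (fun a => if a is Exec i then Some i else None) p.

Definition words_moved (p : seq instr) : nat :=
  count (fun a => if a is Exec _ then false else true) p.

End Machine.

Section Attainment.
Variables (R : realType) (d m : nat) (S : 'I_m -> {set 'I_d}).

(* b l is M^(x_l), rounded and reduced by at most the constant factor c. *)
Definition tile_sizes (c : R) (x : 'cV[R]_d) (M : nat) (b : 'I_d -> nat) :
    Prop :=
  forall l, c * M%:R `^ x l 0 <= (b l)%:R <= M%:R `^ x l 0.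

Definition tile_fits (M : nat) (b : 'I_d -> nat) : Prop :=
  forall j : iteration d, (size (words_of S (tile b j)) <= M)%N.

(* The tiled code with block sizes M^(x_l) up to constant factors attains the
   bound N^d / M^(sigma - 1): suitable reduced block sizes exist for all large
   M, and with any such block sizes dividing N the tiled code reorders the
   original iterations and can be run while moving O(N^d / M^(sigma - 1))
   words. The constant C depends only on the arrays, on x and on c. *)
Definition tiling_attains (x : 'cV[R]_d) (sigma : R) : Prop :=
  (exists2 c : R, 0 < c & exists M0 : nat, forall M : nat, (M0 <= M)%N ->
     exists b : 'I_d -> nat, tile_sizes c x M b /\ tile_fits M b) /\
  (forall c : R, 0 < c -> exists C : R, forall (M N : nat) (b : 'I_d -> nat),
     (0 < M)%N -> (0 < N)%N ->
     tile_sizes c x M b -> tile_fits M b -> (forall l, (b l %| N)%N) ->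
     perm_eq (tiled_code N b) (original_code d N) /\
     exists p : seq (instr d m),
       [/\ legal S M p, executed p = tiled_code N b &
           (words_moved p)%:R <= C * (N%:R ^+ d / M%:R `^ (sigma - 1))]).

End Attainment.

(* Main.v *)
Require Import Defs.
From mathcomp Require Import all_boot all_order all_algebra.
From mathcomp Require Import boolp classical_sets reals exp.
From mathcomp Require Import ring lra zify.

(* By LP duality, obtained from Farkas' lemma, an optimal x of the xLP has
   objective sHBL. A tile with block sizes about M^(x_l) then contains about
   M^sHBL iterations, while the constraints of the xLP say precisely that it
   touches O(M) words of each array. Fetching the words of a tile, running the
   tile and storing them back moves O(M) words, and there are about
   N^d / M^sHBL tiles. *)

Set Implicit Arguments.
Unset Strict Implicit.
Unset Printing Implicit Defensive.

Import Order.TTheory GRing.Theory Num.Theory.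

Local Open Scope ring_scope.

(** * Linear programming duality *)

Lemma mulmx_le0 (R : numDomainType) m n p
    (A : 'M[R]_(m, n)) (B : 'M[R]_(n, p)) :
    (forall i j, 0 <= A i j) -> (forall i j, B i j <= 0) ->
  forall i j, (A *m B) i j <= 0.
Proof.
by move=> A0 B0 i j; rewrite mxE sumr_le0 // => k _; rewrite mulr_ge0_le0.
Qed.

(* Bartl's induction on the number of rows: if the first row [a] is needed,
   some [x0] violates only [a x0 <= 0]; projecting along [x0] onto the kernel
   of [a] removes that row. *)
Lemma farkas (R : realFieldType) m n (A : 'M[R]_(m, n)) (g : 'rV[R]_n) :
    (forall x : 'cV_n, (forall i j, (A *m x) i j <= 0) -> (g *m x) 0 0 <= 0) ->
  exists2 u : 'rV[R]_m, forall i j, 0 <= u i j & u *m A = g.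
Proof.
elim: m A g => [|m IHm]; last rewrite -[m.+1]/(1 + m)%N; move=> A g Ag.
  exists 0 => [i []//|]; rewrite mul0mx; apply/rowP => j; rewrite mxE.
  have Ag' (x : 'cV_n) : (g *m x) 0 0 <= 0 by apply: Ag => -[].
  apply/eqP; rewrite eq_sym eq_le; apply/andP; split.
    by have := Ag' (delta_mx j 0); rewrite -colE mxE.
  by have := Ag' (- delta_mx j 0); rewrite mulmxN -colE !mxE oppr_le0.
move: Ag; rewrite -[A]vsubmxK; move: (usubmx A) (dsubmx A) => a B {A} Ag.
case: (pselect (exists2 x0 : 'cV_n, forall i j, (B *m x0) i j <= 0 &
    0 < (g *m x0) 0 0)) => [[x1 Bx1 gx1]|noB]; last first.
  have [|u u0 <-] := IHm B g.
    by move=> x Bx; rewrite leNgt; apply/negP => gx; apply: noB; exists x.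
  exists (row_mx 0 u); last by rewrite mul_row_col mul0mx add0r.
  by move=> i j; rewrite mxE; case: split => k; rewrite ?mxE.
have ax1 : 0 < (a *m x1) 0 0.
  rewrite ltNge; apply/negP => ax1.
  suff: (g *m x1) 0 0 <= 0 by rewrite leNgt gx1.
  by apply: Ag => i j; rewrite mul_col_mx mxE; case: split => k //;
    rewrite !ord1.
(* Normalised so that [a *m x0 = 1], which makes [P] below the projection along [x0] onto the kernel
   of [a]. *)
pose x0 := ((a *m x1) 0 0)^-1 *: x1.
have ax0 : a *m x0 = 1.
  by apply/matrixP => i j; rewrite !ord1 -scalemxAr mxE mulVf ?gt_eqF// mxE.
have Bx0 i j : (B *m x0) i j <= 0.
  by rewrite -scalemxAr mxE mulr_ge0_le0// invr_ge0 ltW.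
have gx0 : 0 < (g *m x0) 0 0 by rewrite -scalemxAr mxE mulr_gt0// invr_gt0.
pose P := 1%:M - x0 *m a.
have aP : a *m P = 0 by rewrite mulmxBr mulmx1 mulmxA ax0 mul1mx subrr.
have [|u u0 uBP] := IHm (B *m P) (g *m P).
  move=> x BPx; rewrite -mulmxA; apply: Ag => i j.
  rewrite mul_col_mx mxE; case: split => k; last by rewrite mulmxA.
  by rewrite mulmxA aP mul0mx mxE.
(* Expanding [u B P = g P] gives [g = u B + (g x0 - u B x0) a]; the coefficient of [a] is
   nonnegative because [g x0 > 0], [u >= 0] and [B x0 <= 0]. *)
exists (row_mx (g *m x0 - u *m (B *m x0)) u).
  move=> i j; rewrite mxE; case: split => k //.
  by rewrite !ord1 mxE [X in _ + X]mxE subr_ge0 (le_trans _ (ltW gx0))//;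
    apply: mulmx_le0.
rewrite mul_row_col; move: uBP; rewrite /P !mulmxBr !mulmx1 => uBP.
rewrite mulmxBl -!mulmxA addrAC -[RHS](subrK (g *m (x0 *m a))) -uBP.
by rewrite [RHS]addrC addrA.
Qed.

(** Homogenization: with an extra variable [t], the system [A y <= t b], [t >= 0] has a solution
    with [t > 0] exactly when [A x <= b] is solvable. If it is not, Farkas' lemma applies to the
    functional [t]. *)
Lemma farkas_affine (R : realFieldType) m n (A : 'M[R]_(m, n)) (b : 'cV[R]_m) :
  (exists x : 'cV_n, forall i j, (A *m x) i j <= b i j) \/
  (exists u : 'rV[R]_m, [/\ forall i j, 0 <= u i j, u *m A = 0
     & (u *m b) 0 0 < 0]).
Proof.
case: (pselect (exists x : 'cV_n, forall i j, (A *m x) i j <= b i j));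
  first by left.
move=> nox; right.
have [|u u0 uA] := @farkas R (m + 1) (n + 1) (block_mx A (- b) 0 (- 1%:M))
  (row_mx 0 1%:M).
  move=> z; rewrite -[z]vsubmxK; move: (usubmx z) (dsubmx z) => y t {z}.
  rewrite mul_block_col mul_row_col !mul0mx !add0r !mulNmx !mul1mx => Az.
  rewrite leNgt; apply/negP => t0; apply: nox; exists ((t 0 0)^-1 *: y) => i j.
  have := Az (lshift 1 i) 0; rewrite col_mxEu mxE [X in _ + X]mxE.
  rewrite subr_le0 [leRHS]mxE big_ord1 => Ayb.
  by rewrite -scalemxAr mxE ler_pdivrMl// !ord1 mulrC.
move: uA u0; rewrite -[u]hsubmxK; move: (lsubmx u) (rsubmx u) => v r {u}.
rewrite mul_row_block => /eq_row_mx [vA vb] u0.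
exists v; split.
  by move=> i j; have := u0 i (lshift 1 j); rewrite row_mxEl.
  by rewrite -vA mulmx0 addr0.
(* The last column reads [- v b - r = 1], where [r >= 0] is the multiplier of the row [t >= 0];
   hence [v b < 0]. *)
have r0 := u0 0 (rshift m 0); move: r0; rewrite row_mxEr => r0.
move/matrixP/(_ 0 0): vb; rewrite !mulmxN mulmx1 mxE.
rewrite [(- (v *m b)) _ _]mxE [(- r) _ _]mxE [RHS]mxE eqxx mulr1n.
by move: r0; lra.
Qed.

Section Duality.
Variables (R : realType) (d m : nat) (S : 'I_m -> {set 'I_d}).
Implicit Types (x : 'cV[R]_d) (s : 'cV[R]_m).

Lemma objectiveE k (v : 'cV[R]_k) : objective v = \sum_i v i 0.
Proof.
by rewrite /objective mxE; apply: eq_bigr => i _; rewrite !mxE mul1r.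
Qed.

Lemma sLP_feasibleP s : sLP_feasible S s <->
  (forall i, 1 <= (s^T *m Delta R S) 0 i) /\ (forall j, 0 <= s j 0).
Proof.
split=> -[h1 h2]; split.
- by move=> i; have := h1 0 i; rewrite !mxE.
- by move=> j; have := h2 j 0; rewrite !mxE.
- by move=> j i; rewrite !ord1 2!mxE.
- by move=> j i; rewrite !ord1 mxE.
Qed.

Lemma xLP_feasibleP x : xLP_feasible S x <->
  (forall j, (Delta R S *m x) j 0 <= 1) /\ (forall i, 0 <= x i 0).
Proof.
split=> -[h1 h2]; split.
- by move=> i; have := h1 i 0; rewrite [X in _ <= X]mxE.
- by move=> j; have := h2 j 0; rewrite !mxE.
- by move=> j i; rewrite !ord1 [X in _ <= X]mxE.
- by move=> j i; rewrite !ord1 mxE.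
Qed.

(** Both objectives are compared with [s^T Delta x], using [x >= 0] on one side and [s >= 0] on the
    other. *)
Lemma weak_duality x s : xLP_feasible S x -> sLP_feasible S s ->
  objective x <= objective s.
Proof.
move=> /xLP_feasibleP [Dx x0] /sLP_feasibleP [sD s0].
apply: (@le_trans _ _ ((s^T *m Delta R S *m x) 0 0)).
  rewrite objectiveE mxE ler_sum // => i _.
  by rewrite -[leLHS]mul1r ler_wpM2r.
rewrite objectiveE -mulmxA mxE ler_sum // => j _.
by rewrite mxE -[leRHS]mulr1 ler_wpM2l.
Qed.

Hypothesis sLP_is_feasible : exists s : 'cV[R]_m, sLP_feasible S s.

Lemma xLP_objective_le_sHBL x : xLP_feasible S x -> objective x <= sHBL R S.
Proof.
move=> fx; apply: lb_le_inf.
  by have [s fs] := sLP_is_feasible; exists (objective s), s.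
by move=> _ [s fs <-]; exact: weak_duality.
Qed.

Lemma sHBL_le_objective s : sLP_feasible S s -> sHBL R S <= objective s.
Proof.
move=> fs; apply: ge_inf; last by exists s.
exists 0 => _ [t /sLP_feasibleP [_ t0] <-].
by rewrite objectiveE sumr_ge0.
Qed.

(** The affine alternative is applied to [Delta x <= 1], [x >= 0], [1^T x >= sHBL]. Multipliers [q],
    [p], [k] refuting this system would make [q / k] feasible for the sLP with objective below the
    infimum. *)
Lemma strong_duality : exists2 x, xLP_feasible S x & sHBL R S <= objective x.
Proof.
pose A := col_mx (col_mx (Delta R S) (- 1%:M)) (- (ones R d)^T).
pose b : 'cV[R]_(m + d + 1) :=
  col_mx (col_mx (ones R m) 0) (- (sHBL R S)%:M).
have [[x Axb]|[u]] := farkas_affine A b.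
  exists x.
    apply/xLP_feasibleP; split => [j|i].
      have := Axb (lshift 1 (lshift d j)) 0.
      by rewrite !mul_col_mx !col_mxEu [X in _ <= X]mxE.
    have := Axb (lshift 1 (rshift m i)) 0.
    rewrite !mul_col_mx !col_mxEu !col_mxEd mulNmx mul1mx !mxE.
    by rewrite oppr_le0.
  have := Axb (rshift (m + d) 0) 0.
  rewrite !mul_col_mx !col_mxEd mulNmx [leLHS]mxE [leRHS]mxE.
  by rewrite lerN2 [X in X <= _]mxE eqxx mulr1n.
rewrite /A /b -[u]hsubmxK -[lsubmx u]hsubmxK.
move: (lsubmx (lsubmx u)) (rsubmx (lsubmx u)) (rsubmx u) => q p k {u}.
case=> u0; rewrite !mul_row_col => uA ub.
have q0 j : 0 <= q 0 j.
  by have := u0 0 (lshift 1 (lshift d j)); rewrite !row_mxEl.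
have p0 j : 0 <= p 0 j.
  by have := u0 0 (lshift 1 (rshift m j)); rewrite row_mxEl row_mxEr.
have k0 : 0 <= k 0 0.
  by have := u0 0 (rshift (m + d) 0); rewrite row_mxEr.
have qD i : k 0 0 <= (q *m Delta R S) 0 i.
  move/matrixP/(_ 0 i): uA.
  rewrite !mulmxN mulmx1 mxE [X in X + _]mxE [X in _ + X]mxE [(- p) _ _]mxE.
  rewrite [(k *m _) _ _]mxE big_ord1 [trmx _ _ _]mxE [ones _ _ _ _]mxE.
  rewrite mulr1 [RHS]mxE.
  by move: (p0 i); lra.
have qk : \sum_j q 0 j < k 0 0 * sHBL R S.
  move: ub; rewrite mulmxN mulmx0 addr0 mul_mx_scalar mxE.
  rewrite [X in _ + X]mxE [X in _ - X]mxE subr_lt0 mulrC mxE.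
  by under eq_bigr do rewrite mxE mulr1.
(* For [k = 0] the inequality [qk] would make a sum of nonnegative entries negative. *)
have {}k0 : 0 < k 0 0.
  rewrite lt_neqAle k0 andbT; apply/eqP => kE.
  by move: qk; rewrite -kE mul0r ltNge sumr_ge0.
pose s := (k 0 0)^-1 *: q^T.
suff fs : sLP_feasible S s.
  have := sHBL_le_objective fs; rewrite objectiveE leNgt.
  under eq_bigr do rewrite !mxE.
  by rewrite -mulr_sumr ltr_pdivrMl// qk.
apply/sLP_feasibleP; split=> [i|j]; last first.
  by rewrite !mxE mulr_ge0// invr_ge0 ltW.
by rewrite linearZ /= trmxK -scalemxAl mxE ler_pdivlMl// mulr1.
Qed.

Lemma xLP_optimal_exists : exists x, xLP_optimal S x.
Proof.
have [x fx ox] := strong_duality; exists x; split=> // y fy.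
exact: le_trans (xLP_objective_le_sHBL fy) ox.
Qed.

Lemma xLP_optimal_ge_sHBL x : xLP_optimal S x -> sHBL R S <= objective x.
Proof.
by case=> _ xmax; have [y fy oy] := strong_duality;
  apply: le_trans oy (xmax y fy).
Qed.

End Duality.

(** * Iteration order of loop nests *)

Section LoopNests.
Local Open Scope nat_scope.

Lemma size_lex_product (rs : seq (seq nat)) :
  size (lex_product rs) = \prod_(r <- rs) size r.
Proof.
by elim: rs => [|r rs IH] /=; rewrite ?big_nil// size_allpairs IH big_cons.
Qed.

Lemma lex_product_uniq (rs : seq (seq nat)) : all uniq rs ->
  uniq (lex_product rs).
Proof.
elim: rs => [|r rs IH] //= /andP[ur urs].
by apply: allpairs_uniq => [||[i t] [j u] _ _ [-> ->]] //; exact: IH.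
Qed.

Lemma mem_lex_product (I : eqType) (r : I -> seq nat) (s : seq I)
    (t : seq nat) :
  t \in lex_product (map r s) =
  (size t == size s) && all (fun p => p.1 \in r p.2) (zip t s).
Proof.
elim: s t => [|k s IH] [|x t] //; rewrite [LHS]/=.
  by apply/negP => /allpairsP[[? ?] [/= _ _]].
rewrite eqSS; apply/allpairsP/idP => [[[y u] /= [yr ut [-> ->]]]|].
  by rewrite yr -IH.
by rewrite andbCA -IH => /andP[xr tl]; exists (x, t).
Qed.

Lemma map_mem_lex_product (I : eqType) (r : I -> seq nat) (s : seq I)
    (f : I -> nat) :
  {in s, forall k, f k \in r k} -> map f s \in lex_product (map r s).
Proof.
rewrite mem_lex_product size_map eqxx /= => fr.
by elim: s fr => //= k s IH fr; rewrite fr ?mem_head// IH// => x xs;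
  rewrite fr// inE xs orbT.
Qed.

Variable d : nat.
Implicit Types (r : 'I_d -> seq nat) (f : iteration d).

Lemma mem_loop_nest r f : reflect (forall k, f k \in r k) (f \in loop_nest r).
Proof.
apply: (iffP mapP) => [[t]|fr].
  rewrite mem_lex_product size_enum_ord => /andP[/eqP st /allP tr] -> k.
  rewrite ffunE; apply: (tr (_, _)).
  suff -> : (nth 0 t k, k) = nth (0, k) (zip t (enum 'I_d)) k.
    by rewrite mem_nth// size_zip st size_enum_ord minnn.
  by rewrite nth_zip ?st ?size_enum_ord// nth_ord_enum.
exists [seq f k | k <- enum 'I_d]; first exact: map_mem_lex_product.
apply/ffunP => k; rewrite ffunE (nth_map k) ?size_enum_ord//.
by rewrite nth_ord_enum.
Qed.

Lemma loop_nest_uniq r : (forall k, uniq (r k)) -> uniq (loop_nest r).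
Proof.
move=> ur; rewrite map_inj_in_uniq.
  by apply: lex_product_uniq; rewrite all_map; apply/allP => k _ /=.
move=> t u; rewrite !mem_lex_product size_enum_ord.
move=> /andP[/eqP st _] /andP[/eqP su _] /ffunP tu.
apply: (@eq_from_nth _ 0); rewrite ?st ?su// => i id.
by have := tu (Ordinal id); rewrite !ffunE.
Qed.

Lemma size_loop_nest r : size (loop_nest r) = \prod_k size (r k).
Proof. by rewrite size_map size_lex_product big_map big_enum. Qed.

Lemma mem_colon start step stop i :
  (i \in colon start step stop) =
  [&& start <= i, i <= stop & step %| i - start].
Proof.
rewrite mem_filter mem_iota andbC -andbA.
case: (leqP start i) => //= si; congr (_ && _); apply/idP/idP; lia.
Qed.

Lemma colon_uniq start step stop : uniq (colon start step stop).
Proof. by rewrite filter_uniq ?iota_uniq. Qed.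

Lemma size_colon_unit start stop : size (colon start 1 stop) = stop.+1 - start.
Proof.
by rewrite /colon (eq_filter (a2 := predT)) ?filter_predT ?size_iota // => i;
  rewrite dvd1n.
Qed.

(** Counts the block starts [k * b + 1] with [k < n %/ b]. *)
Lemma size_colon_dvd b n : 0 < b -> b %| n -> size (colon 1 b n) = n %/ b.
Proof.
move=> b0 /dvdnP[q ->]; rewrite mulnK// -[RHS](size_iota 0).
rewrite -[RHS](size_map (fun k => k * b + 1)).
apply/perm_size/uniq_perm; first exact: colon_uniq.
  by rewrite map_inj_uniq ?iota_uniq// => x y /addIn /eqP;
    rewrite eqn_pmul2r// => /eqP.
move=> i; rewrite mem_colon; apply/and3P/mapP => [[i1 iq /dvdnP[k ki]]|[k]].
  exists k; last lia.
  rewrite mem_iota /= add0n -(ltn_pmul2r b0); lia.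
rewrite mem_iota add0n => /= kq ->; split; rewrite ?addnK ?dvdn_mull//;
  first lia.
by rewrite -(ltn_pmul2r b0) in kq; rewrite addn1.
Qed.

(** The flattened list of tiles unfolds to a single [allpairs], whose uniqueness and membership
    lemmas then apply. *)
Lemma tiled_codeE N (b : 'I_d -> nat) :
  tiled_code N b = [seq [ffun l => (j l + k l)%N] : iteration d
    | j : iteration d <- loop_nest (fun l => colon 1 (b l) N),
      k : iteration d <- loop_nest (fun l => colon 0 1 (b l).-1)].
Proof. by []. Qed.

(** Loops start at 1, so [j - 1] is a multiple of [b], while [k < b]; Euclidean division of
    [j + k - 1] recovers both. Hence block start and offset are determined by the iteration. *)
Lemma tile_index_divmod b N j k :
  0 < b -> j \in colon 1 b N -> k \in colon 0 1 b.-1 ->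
  j = (j + k).-1 %/ b * b + 1 /\ k = (j + k).-1 %% b.
Proof.
move=> b0; rewrite !mem_colon => /and3P[j1 _ /dvdnP[q jq]] /and3P[_ kb _].
have kb' : k < b by lia.
have -> : (j + k).-1 = q * b + k by lia.
rewrite divnMDl// modnMDl divn_small// modn_small//; lia.
Qed.

(** Both lists are duplicate-free, so comparing their members suffices. *)
Lemma tiled_code_perm N (b : 'I_d -> nat) :
  (forall l, 0 < b l) -> (forall l, b l %| N) ->
  perm_eq (tiled_code N b) (original_code d N).
Proof.
move=> b0 bN; rewrite tiled_codeE; apply: uniq_perm.
- apply: allpairs_uniq; do ?by apply: loop_nest_uniq => k; exact: colon_uniq.
  move=> [j k] [j' k'].
  move=> /allpairsP[[? ?] /= [/mem_loop_nest jr /mem_loop_nest kr [-> ->]]].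
  move=> /allpairsP[[? ?] /= [/mem_loop_nest jr' /mem_loop_nest kr' [-> ->]]].
  move=> /ffunP e.
  have E l := tile_index_divmod (b0 l) (jr l) (kr l).
  have E' l := tile_index_divmod (b0 l) (jr' l) (kr' l).
  congr pair; apply/ffunP => l; have := e l; rewrite !ffunE => el.
    by rewrite (E l).1 (E' l).1 el.
  by rewrite (E l).2 (E' l).2 el.
- by apply: loop_nest_uniq => k; exact: colon_uniq.
move=> i; apply/allpairsP/mem_loop_nest => [[[j k] /=]|ir].
  move=> [/mem_loop_nest jr /mem_loop_nest kr ->] l.
  have /dvdnP[n Nn] := bN l; have b0l := b0 l.
  move: (jr l) (kr l); rewrite !mem_colon dvd1n ffunE =>
    /and3P[j1 jN /dvdnP[q jq]] /and3P[_ kb _].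
  (* From [q * b l + 1 <= n * b l] follows [q < n], so the whole block stays below [N]. *)
  have : q < n by rewrite -(ltn_pmul2r b0l); lia.
  rewrite -(leq_pmul2r b0l) mulSn => qn; lia.
have ir' l : (i l).-1 < N.
  by have := ir l; rewrite mem_colon => /and3P[i1 iN _]; rewrite prednK.
(* Block start and offset come from Euclidean division of [i l - 1] by [b l]. *)
exists ([ffun l => (i l).-1 %/ b l * b l + 1], [ffun l => (i l).-1 %% b l]);
  split => /=.
- apply/mem_loop_nest => l; rewrite ffunE mem_colon addnK dvdn_mull// andbT
  addn1 /=.
  exact: leq_ltn_trans (leq_trunc_div _ _) (ir' l).
- apply/mem_loop_nest => l; rewrite ffunE mem_colon dvd1n /= andbT.
  by rewrite -ltnS prednK// ltn_pmod.
apply/ffunP => l; rewrite !ffunE.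
have := ir l; rewrite mem_colon => /and3P[i1 _ _].
by rewrite addnAC -divn_eq addn1 prednK.
Qed.

Lemma size_tiles N (b : 'I_d -> nat) :
  (forall l, 0 < b l) -> (forall l, b l %| N) ->
  size (loop_nest (fun l => colon 1 (b l) N)) = \prod_l (N %/ b l).
Proof.
by move=> b0 bN; rewrite size_loop_nest; apply: eq_bigr => l _;
  rewrite size_colon_dvd.
Qed.

Variables (m : nat) (S : 'I_m -> {set 'I_d}).

(** The entries of array [a] touched by the tile lie in a box whose sides are the blocks [b l] with
    [l \in S a]; [W a] enumerates this box. *)
Lemma size_words_of_tile (b : 'I_d -> nat) (j : iteration d) :
  (forall l, 0 < b l) ->
  size (words_of S (tile b j)) <= \sum_a \prod_(l in S a) b l.
Proof.
move=> b0.
pose W (a : 'I_m) : seq (word m) := [seq (a, v) | v <- lex_product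
  [seq [seq j l + k | k <- colon 0 1 (b l).-1] | l <- enum (S a)]].
have sW a : size (W a) = \prod_(l in S a) b l.
  rewrite size_map size_lex_product big_map big_enum; apply: eq_bigr => l _.
  by rewrite size_map size_colon_unit subn0 prednK.
under eq_bigr do rewrite -sW.
have <- : size (flatten [seq W a | a <- enum 'I_m]) = \sum_a size (W a).
  by rewrite size_flatten sumnE /shape -map_comp big_map big_enum.
apply: uniq_leq_size; first exact: undup_uniq.
move=> w; rewrite mem_undup => /flatten_mapP[i it /mapP[a _ ->]].
apply/flatten_mapP; exists a; first exact: mem_enum.
apply/map_f/map_mem_lex_product => l _.
move: it => /mapP[k /mem_loop_nest kr ->]; rewrite ffunE; exact: map_f.
Qed.

End LoopNests.

(** * Running the tiles in fast memory *)

Section Execution.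
Variables (d m : nat) (S : 'I_m -> {set 'I_d}) (M : nat).
Local Open Scope nat_scope.

Let run (F : seq (word m)) (p : seq (instr d m)) :=
  foldl (fun o a => obind (fun F => step S M F a) o) (Some F) p.

(* Storing in the reverse order of fetching keeps the word to be stored at the
   head of fast memory. *)
Definition tile_program (its : seq (iteration d)) : seq (instr d m) :=
  let W := words_of S its in
  [seq Fetch d w | w <- W] ++ [seq Exec m i | i <- its]
    ++ [seq Store d w | w <- rev W].

(** Each fetch puts its word at the head, so [W] ends up reversed; distinctness ensures that no
    fetched word is already present. *)
Lemma run_fetch F W : uniq (W ++ F) -> size W + size F <= M ->
  run F [seq Fetch d w | w <- W] = Some (catrev W F).
Proof.
elim: W F => //= w W IH F /andP[wWF uWF] sWF.
have wF : w \notin F by move: wWF; rewrite mem_cat negb_or => /andP[].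
rewrite /run /= wF (leq_trans _ sWF) ?leq_addl /=;
  last by rewrite addSn ltnS leq_addl.
apply: IH; last by rewrite /= addnS -addSn.
by rewrite (perm_uniq (permEl (perm_catCA W [:: w] F))) /= wWF.
Qed.

Lemma run_exec F its : {subset words_of S its <= F} ->
  run F [seq Exec m i | i <- its] = Some F.
Proof.
elim: its => //= i its IH sub; rewrite /run /=.
rewrite ifT; last first.
  apply/allP => w wi; apply: sub; rewrite mem_undup mem_cat wi //.
by apply: IH => w; rewrite mem_undup => wi; apply: sub;
  rewrite mem_undup mem_cat wi orbT.
Qed.

Lemma run_store F : run F [seq Store d w | w <- F] = Some [::].
Proof. by elim: F => //= w F IH; rewrite /run /= mem_head /= eqxx. Qed.

Lemma legal_tile_program its :
  size (words_of S its) <= M -> legal S M (tile_program its).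
Proof.
move=> fits; rewrite /legal /tile_program !foldl_cat.
rewrite [foldl _ (Some [::]) _]run_fetch ?cats0 ?addn0 ?undup_uniq//.
rewrite [foldl _ (Some (catrev _ _)) _]run_exec.
  by rewrite catrevE cats0; exact: run_store.
by move=> w; rewrite catrevE cats0 mem_rev.
Qed.

(** Each piece starts and ends with empty fast memory, so the pieces can be chained. *)
Lemma legal_flatten (T : Type) (f : T -> seq (instr d m)) (xs : seq T) :
  (forall x, legal S M (f x)) -> legal S M (flatten (map f xs)).
Proof.
by move=> lf; elim: xs => //= x xs IH;
  rewrite /legal foldl_cat [foldl _ _ (f x)]lf.
Qed.

Lemma executed_cat (p q : seq (instr d m)) :
  executed (p ++ q) = executed p ++ executed q.
Proof. exact: pmap_cat. Qed.

Lemma executed_tile_program its : executed (tile_program its) = its.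
Proof.
have ex0 (f : word m -> instr d m) W :
    (forall w, executed [:: f w] = [::]) -> executed (map f W) = [::].
  by move=> f0; elim: W => // w W IH; rewrite map_cons -cat1s executed_cat f0.
rewrite /tile_program !executed_cat !ex0// cats0 /=.
by elim: its => //= i its IH; rewrite -[in RHS]IH.
Qed.

Lemma words_moved_tile_program its :
  words_moved (tile_program its) = (size (words_of S its)).*2.
Proof.
rewrite /words_moved /tile_program !count_cat !count_map.
rewrite (eq_count (a2 := predT)) // count_predT.
rewrite [X in _ + (X + _)](eq_count (a2 := pred0)) // count_pred0 add0n.
by rewrite (eq_count (a2 := predT)) // count_predT size_rev addnn.
Qed.

(** The tiles run one after another, each moving its at most [M] words in once and out once. *)
Lemma run_tiled_code N (b : 'I_d -> nat) : tile_fits S M b ->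
  exists p : seq (instr d m),
    [/\ legal S M p, executed p = tiled_code N b
      & words_moved p <= (M * size (loop_nest (fun l => colon 1 (b l) N))).*2].
Proof.
move=> fits; rewrite /tiled_code; set js := loop_nest _.
exists (flatten [seq tile_program (tile b j) | j <- js]); split.
- by apply: legal_flatten => j; exact: legal_tile_program.
- by elim: js => //= j js IH; rewrite executed_cat executed_tile_program IH.
elim: js => //= j js IH; rewrite /words_moved count_cat mulnS doubleD leq_add//.
by rewrite -/(words_moved _) words_moved_tile_program leq_double.
Qed.

End Execution.

(** * Communication cost *)

Lemma powR_sum (R : realType) (I : finType) (P : pred I) (a : R) (f : I -> R) :
  0 < a -> \prod_(i | P i) a `^ f i = a `^ (\sum_(i | P i) f i).
Proof.
move=> a0; apply: (big_ind2 (fun p e => p = a `^ e)) => [|_ e _ f' -> ->|//].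
  by rewrite powRr0.
by rewrite powRD ?(gt_eqF a0) ?implybT.
Qed.

Lemma powR_eventually_ge (R : realType) (e K : R) : 0 < e -> 0 <= K ->
  exists T : nat, forall M : nat, (T <= M)%N -> K <= M%:R `^ e.
Proof.
move=> e0 K0; exists (Num.truncn (K `^ e^-1)).+1 => M TM.
have KM : K `^ e^-1 <= M%:R.
  by rewrite (le_trans (ltW (truncnS_gt _)))// ler_nat.
rewrite -[leLHS](powRr1 K0) -[X in K `^ X](mulVf (lt0r_neq0 e0)) powRrM.
by apply: ge0_ler_powR; rewrite ?nnegrE ?powR_ge0 ?ler0n ?(ltW e0).
Qed.

(** The integer part [n] satisfies [n >= 1], whence [t < n + 1 <= 2 n]. *)
Lemma truncn_ge_half (R : realType) (t : R) : 1 <= t ->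
  t / 2 <= (Num.truncn t)%:R.
Proof.
move=> t1; have t0 : 0 <= t by lra.
have /andP[_ tn] := truncn_itv t0.
have : 1 <= (Num.truncn t)%:R :> R by rewrite ler1n truncn_gt0.
by move: tn; rewrite -natr1; lra.
Qed.

(** Chooses a block size from the ideal size [t = M^(x_l)] and a reduction factor [K]. For [t >= K],
    rounding [t / K] down costs at most another factor 2; for [t < K], size 1 is already within the
    factor [K]. *)
Lemma reduced_size (R : realType) (K t : R) : 1 <= K -> 1 <= t ->
  exists n : nat, [/\ (0 < n)%N, (K * 2)^-1 * t <= n%:R <= t
    & K <= t -> n%:R <= K^-1 * t].
Proof.
move=> K1 t1; have K0 : 0 < K by lra.
have Kt0 : 0 <= K^-1 * t by rewrite mulr_ge0 ?invr_ge0; lra.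
have Ktt : K^-1 * t <= t by rewrite ler_pdivrMl// ler_peMl; lra.
have [Kt|tK] := leP K t.
  have Kt1 : 1 <= K^-1 * t by rewrite ler_pdivlMl// mulr1.
  have trt : (Num.truncn (K^-1 * t))%:R <= K^-1 * t by rewrite truncn_le.
  exists (Num.truncn (K^-1 * t)); split; rewrite ?truncn_gt0//.
  rewrite (le_trans trt)// andbT invfM mulrAC; exact: truncn_ge_half.
exists 1%N; split=> //.
by rewrite t1 andbT ler_pdivrMl ?mulr1; lra.
Qed.

Section Attain.
Variables (R : realType) (d m : nat) (S : 'I_m -> {set 'I_d}).
Variables (x : 'cV[R]_d).
Hypothesis x_feasible : xLP_feasible S x.

Lemma xLP_feasible_sum a : \sum_(l in S a) x l 0 <= 1.
Proof.
have /xLP_feasibleP [/(_ a) + _] := x_feasible.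
rewrite mxE [X in _ -> X <= _]big_mkcond; congr (_ <= _).
by apply: eq_bigr => l _; rewrite mxE; case: ifP; rewrite ?mul1r ?mul0r.
Qed.

Lemma fitting_tile_sizes_exist :
  exists2 c : R, 0 < c & exists M0 : nat, forall M : nat, (M0 <= M)%N ->
     exists b : 'I_d -> nat, tile_sizes c x M b /\ tile_fits S M b.
Proof.
have /xLP_feasibleP [_ x0] := x_feasible.
(* If each of the [m] arrays contributes at most [M / (m + 1)] words, the tile fits in [M] words. *)
pose K : R := m.+1%:R.
have K1 : 1 <= K by rewrite ler1n.
have K0 : 0 < K by lra.
exists (K * 2)^-1; first by rewrite invr_gt0; lra.
(* Where [x l 0 > 0], the ideal size eventually reaches [K], so block [l] can be reduced by the full
   factor; where [x l 0 = 0] it stays 1 and no threshold is imposed. *)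
have /choice[T KT] : forall l, exists T : nat,
    forall M : nat, (T <= M)%N -> 0 < x l 0 -> K <= M%:R `^ x l 0.
  move=> l; have [xl|xl] := ltP 0 (x l 0); last by exists 0%N.
  by have [T hT] := powR_eventually_ge xl (ltW K0); exists T => M /hT.
(* The bound [m.+1] ensures [1 <= M / K], which covers an array of which the tile touches a single
   word. *)
exists (maxn m.+1 (\max_l T l)) => M; rewrite geq_max => /andP[mM TM].
have {TM} KM l : 0 < x l 0 -> K <= M%:R `^ x l 0.
  by apply: KT; apply: leq_trans TM; exact: leq_bigmax.
have M0 : 0 < M%:R :> R by rewrite ltr0n (leq_trans _ mM).
have M1 : 1 <= M%:R :> R by rewrite ler1n (leq_trans _ mM).
have t1 l : 1 <= M%:R `^ x l 0 by rewrite -[leLHS](powRr0 M%:R) ler_powR.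
have /choice[b bP] : forall l, exists n : nat, [/\ (0 < n)%N,
    (K * 2)^-1 * M%:R `^ x l 0 <= n%:R <= M%:R `^ x l 0
    & K <= M%:R `^ x l 0 -> n%:R <= K^-1 * M%:R `^ x l 0].
  by move=> l; exact: reduced_size.
exists b; split=> [l|j]; first by have [] := bP l.
have b0 l : (0 < b l)%N by have [] := bP l.
have bt l : (b l)%:R <= M%:R `^ x l 0 by have [_ /andP[]] := bP l.
apply: leq_trans (size_words_of_tile S j b0) _.
suff bS a : \prod_(l in S a) (b l)%:R <= K^-1 * M%:R :> R.
  rewrite -(ler_nat R) natr_sum.
  apply: (@le_trans _ _ (\sum_(a < m) K^-1 * M%:R)).
    by apply: ler_sum => a _; rewrite natr_prod.
  rewrite sumr_const card_ord -[leLHS]mulr_natl mulrA ler_piMl ?ltW//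
    ltr_pdivrMr// mul1r.
  by rewrite ltr_nat.
have pS (P : pred 'I_d) : \prod_(l in S a | P l) (b l)%:R <=
    \prod_(l in S a | P l) M%:R `^ x l 0 :> R.
  by apply: ler_prod => l _; rewrite ler0n bt.
(* The xLP constraint of array [a] bounds the total exponent by 1. *)
have SM : \prod_(l in S a) M%:R `^ x l 0 <= M%:R :> R.
  rewrite powR_sum//; apply: (le_trans (ler_powR M1 (xLP_feasible_sum a))).
  by rewrite powRr1 ?(ltW M0).
(* Either some block of the array is reduced by the full factor K, or all its
   blocks have size 1 and the tile touches a single word of it. *)
have [[l lS xl]|nox] := pselect (exists2 l, l \in S a & 0 < x l 0).
  apply: (@le_trans _ _ (K^-1 * \prod_(l in S a) M%:R `^ x l 0)); last first.
    by rewrite ler_pM2l// invr_gt0.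
  (* Block [l] supplies the factor [K^-1]; the other blocks are bounded by their ideal sizes. *)
  rewrite (bigD1 l)//= [in leRHS](bigD1 l)//= mulrA ler_pM ?prodr_ge0//.
  by have [_ _ ->] := bP l; rewrite ?KM.
apply: (@le_trans _ _ 1); last by rewrite ler_pdivlMl// mulr1 ler_nat.
rewrite big1 // => l lS; apply/eqP; rewrite pnatr_eq1 eqn_leq b0 andbT
  -(ler_nat R).
rewrite (le_trans (bt l))//.
have -> : x l 0 = 0; last by rewrite powRr0.
by apply/eqP; rewrite eq_le x0 andbT leNgt; apply/negP => xl; apply: nox;
  exists l.
Qed.

(** A larger objective means larger tiles and hence fewer of them, so a lower bound [sigma] on it
    suffices. *)
Lemma tiled_code_attains (sigma c : R) : sigma <= objective x -> 0 < c ->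
  exists C : R, forall (M N : nat) (b : 'I_d -> nat),
     (0 < M)%N -> (0 < N)%N ->
     tile_sizes c x M b -> tile_fits S M b -> (forall l, (b l %| N)%N) ->
     perm_eq (tiled_code N b) (original_code d N) /\
     exists p : seq (instr d m),
       [/\ legal S M p, executed p = tiled_code N b &
           (words_moved p)%:R <= C * (N%:R ^+ d / M%:R `^ (sigma - 1))].
Proof.
(* The 2 counts the fetch and the store of each word; [c ^+ d] bounds the loss in tile volume over
   the [d] block sizes. *)
move=> sx c0; exists (2 / c ^+ d) => M N b M0 N0 bx fits bN.
have b0 l : (0 < b l)%N by apply: dvdn_gt0 (bN l).
split; first exact: tiled_code_perm.
have [p [lp ep wp]] := run_tiled_code N fits; exists p; split=> //.
have M0R : 0 < M%:R :> R by rewrite ltr0n.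
have M1R : 1 <= M%:R :> R by rewrite ler1n.
have tilesE : (\prod_l (N %/ b l))%:R = N%:R ^+ d / \prod_l (b l)%:R :> R.
  rewrite natr_prod -[in N%:R ^+ d](card_ord d) -prodr_const -prodf_div.
  by apply: eq_bigr => l _; rewrite natf_div.
have bprod : c ^+ d * M%:R `^ objective x <= \prod_l (b l)%:R.
  rewrite objectiveE -powR_sum// -[in c ^+ d](card_ord d) -prodr_const
    -big_split /=.
  apply: ler_prod => l _; have /andP[-> _] := bx l.
  by rewrite mulr_ge0 ?powR_ge0 ?ltW.
(* At most [2 * M] words per tile, times the number of tiles. *)
apply: (@le_trans _ _ (2 * (M%:R * (N%:R ^+ d / \prod_l (b l)%:R)))).
  rewrite -tilesE -natrM -natrM ler_nat mul2n.
  by rewrite -(size_tiles b0 bN).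
apply: (@le_trans _ _
  (2 * (M%:R * (N%:R ^+ d / (c ^+ d * M%:R `^ objective x))))).
  rewrite ler_pM2l// ler_pM2l// ler_pM2l ?exprn_gt0 ?ltr0n//.
  rewrite lef_pV2 ?posrE// ?mulr_gt0 ?exprn_gt0 ?powR_gt0//.
  by apply: prodr_gt0 => l _; rewrite ltr0n.
have -> : 2 * (M%:R * (N%:R ^+ d / (c ^+ d * M%:R `^ objective x))) =
    2 / c ^+ d * (N%:R ^+ d / M%:R `^ (objective x - 1)).
  rewrite powRB ?(gt_eqF M0R) ?implybT// powRr1 ?ltW//.
  field.
  by rewrite !gt_eqF ?powR_gt0 ?exprn_gt0 ?ltr0n.
rewrite ler_pM2l ?divr_gt0 ?exprn_gt0// ler_pM2l ?exprn_gt0 ?ltr0n//.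
by rewrite lef_pV2 ?posrE ?powR_gt0// ler_powR// lerB.
Qed.

End Attain.

Theorem theorem7p1 (R : realType) (d m : nat) (S : 'I_m -> {set 'I_d})
    (sLP_is_feasible : exists s : 'cV[R]_m, sLP_feasible S s) :
  (exists x : 'cV[R]_d, xLP_feasible S x) /\
  (exists x : 'cV[R]_d, xLP_optimal S x) /\
  (forall x : 'cV[R]_d, xLP_optimal S x -> tiling_attains S x (sHBL R S)).
Proof.
have [x xopt] := xLP_optimal_exists sLP_is_feasible.
split; first by exists x; case: xopt.
split; first by exists x.
(* Fitting block sizes come from the feasibility of [y]; the cost bound uses its optimality through
   strong duality. *)
move=> y yopt; split; first exact: fitting_tile_sizes_exist yopt.1.
by move=> c c0; apply: tiled_code_attains c0; exact: xLP_optimal_ge_sHBL.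
Qed.
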